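(* The algorithm NylF described in the context halts for every input $w\in A^+$ and outputs the Nyldon factorization of $w$. Moreover, the worst case complexity of this algorithm is $O\big(\frac{n(n-1)}{2}\big)$, where $n$ is the length of the input $w$.
   Context: $A$ is a finite alphabet of cardinality at least $2$ with a total order $<$. $A^+$ is the set of nonempty finite words over $A$, $|w|$ is the length of $w$, $w[i]$ is the $i$th letter of $w$. The lexicographic order $<_{\mathrm{lex}}$ is the total order given by: $u<_{\mathrm{lex}}v$ if $u$ is a proper prefix of $v$, or there exist letters $i<j$ and a word $p$ such that $pi$ is a prefix of $u$ and $pj$ is a prefix of $v$; $u\le_{\mathrm{lex}}v$ means $u<_{\mathrm{lex}}v$ or $u=v$, and $u>_{\mathrm{lex}}v$ means $v<_{\mathrm{lex}}u$. Nyldon words are nonempty words defined recursively on length: every letter (word of length $1$) is Nyldon; a word $w$ of length at least $2$ is Nyldon if and only if there is no sequence $(n_1,\ldots,n_k)$ of Nyldon words with $w=n_1\cdots n_k$, $\max\{|n_1|,\ldots,|n_k|\}<|w|$ and $n_1\le_{\mathrm{lex}}\cdots\le_{\mathrm{lex}}n_k$. The Nyldon factorization of $w$ is the sequence $(n_1,\ldots,n_k)$ of Nyldon words, which exists and is unique for each $w$, with $w=n_1\cdots n_k$ and $n_1\le_{\mathrm{lex}}\cdots\le_{\mathrm{lex}}n_k$. Algorithm NylF, on input $w\in A^+$: set $n\leftarrow|w|$ and initialize a list of words $N\leftarrow(w[n])$. For $i=1,\ldots,n-1$ successively: prepend the letter $w[n-i]$ to $N$; then, while $N$ has at least two elements and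 its first element $N(1)$ and second element $N(2)$ satisfy $N(1)>_{\mathrm{lex}}N(2)$, replace these two elements by the single element $N(1)\cdot N(2)$ (their concatenation), keeping the rest of the list unchanged. After the last iteration, return $N$. *)

(* Defs.v *)
From HB Require Import structures.
From mathcomp Require Import all_boot all_order.
Set Implicit Arguments.
Unset Strict Implicit.
Unset Printing Implicit Defensive.
Import Order.TTheory.

Section NyldonWords.
Context {d : Order.disp_t} {A : finOrderType d}.
Implicit Types (u v w : seq A) (s N : seq (seq A)).

Definition lex_le u v : bool := ((u : seqlexi A) <= (v : seqlexi A))%O.
Definition lex_lt u v : bool := ((u : seqlexi A) < (v : seqlexi A))%O.

Lemma lex_ltP u v :
  lex_lt u v <->
  (prefix u v /\ u <> v) \/
  exists p (i j : A),
    [/\ (i < j)%O, prefix (rcons p i) u & prefix (rcons p j) v].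
Proof.
elim: u v => [|a u IH] [|b v]; rewrite /lex_lt ?ltxi0s ?ltxis0.
- by split=> // -[[]//|[[|? ?] [? [? []]]]].
- by split=> // _; left.
- by split=> // -[[]//|[[|? ?] [? [? []]]]].
rewrite ltxi_cons; split.
  case/andP=> le_ab /implyP lt_uv; case: (comparable_ltgtP (comparableT a b)) le_ab => //.
    by move=> lt_ab _; right; exists [::], a, b; rewrite /= !eqxx !prefix0s.
  move=> eq_ab _; rewrite -{b}eq_ab in lt_uv *.
  have /IH[[pr ne]|[p [i [j [? ? ?]]]]] := lt_uv (lexx a).
    by left; rewrite /= eqxx pr; split=> // -[].
  by right; exists (a :: p), i, j; rewrite /= eqxx.
case=> [[/= /andP[/eqP<- pr] ne]|[[|c p] [i [j []]]]] /=.
- by rewrite lexx; apply/IH; left; split=> // e; apply: ne; rewrite e.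
- by move=> lt_ij /andP[/eqP<- _] /andP[/eqP<- _]; rewrite (ltW lt_ij) leNgt lt_ij.
- move=> lt_ij /andP[/eqP<- pu] /andP[/eqP<- pv]; rewrite lexx.
  by apply/IH; right; exists p, i, j.
Qed.

(* The recursion on the length is carried by the first argument, which bounds
   the length of the word; [nyldonE] is the recursive definition itself. *)
Fixpoint nyldon_upto (m : nat) (w : seq A) : Prop :=
  if m is m'.+1 then
    size w = 1 \/
    2 <= size w /\
    ~ exists s, [/\ forall u, u \in s -> nyldon_upto m' u,
                    w = flatten s,
                    forall u, u \in s -> size u < size w
                  & sorted lex_le s]
  else False.

Definition nyldon w : Prop := nyldon_upto (size w) w.

Lemma nyldon_upto_ext m m' w :
  size w <= m -> size w <= m' -> nyldon_upto m w <-> nyldon_upto m' w.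
Proof.
elim: m m' w => [|m IH] [|m'] [|a w] //= le_m le_m'.
- by split=> // -[|[]].
- by split=> // -[|[]].
- by split=> -[|[]].
by split=> -[|[le2 no]]; [left|right|left|right] => //; split=> // -[s [ny ew sz so]];
  apply: no; exists s; split=> // u us; have le_u : size u <= size w := sz u us;
  have := ny u us; apply IH; apply: leq_trans le_u _.
Qed.

Lemma nyldonE w :
  nyldon w <->
  size w = 1 \/
  2 <= size w /\
  ~ exists s, [/\ forall u, u \in s -> nyldon u,
                  w = flatten s,
                  forall u, u \in s -> size u < size w
                & sorted lex_le s].
Proof.
rewrite /nyldon; case: w => [|a w] /=; first by split=> // -[|[]].
by split=> -[|[le2 no]]; [left|right|left|right] => //; split=> // -[s [ny ew sz so]];
  apply: no; exists s; split=> // u us; have := ny u us;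
  apply nyldon_upto_ext => //; apply: sz us.
Qed.

Definition nyldon_factorization w s : Prop :=
  [/\ forall u, u \in s -> nyldon u, w = flatten s & sorted lex_le s].

(* w[j], with positions counted from 1 *)
Definition letter w (j : nat) : option A :=
  if j is j'.+1 then onth w j' else None.

(* Program points of NylF on a fixed input w: [Init], the initialization;
   [For i N], about to test i <= |w| - 1; [While i N], about to test the guard
   of the inner loop in the i-th iteration; [Return N], terminated. *)
Inductive nylF_state : Type :=
| Init
| For of nat & seq (seq A)
| While of nat & seq (seq A)
| Return of seq (seq A).

(* Number of letter comparisons made when u and v are scanned from left to
   right until they differ or one of them is exhausted *)
Fixpoint lex_cost u v : nat :=
  match u, v with
  | a :: u', b :: v' => if a == b then (lex_cost u' v').+1 else 1
  | _, _ => 0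
  end.

(* One step, with the number of elementary operations it costs: one operation
   for control, for reading a letter and for updating the front of the list,
   one per letter comparison, and one per letter written by a concatenation.
   [None] means that the machine cannot move. *)
Definition nylF_step w (c : nylF_state) : option (nylF_state * nat) :=
  match c with
  | Init =>
      if letter w (size w) is Some a then Some (For 1 [:: [:: a]], 1) else None
  | For i N =>
      if i <= size w - 1 then
        if letter w (size w - i) is Some a
        then Some (While i ([:: a] :: N), 1) else None
      else Some (Return N, 1)
  | While i N =>
      if N is u :: v :: N' then
        if lex_lt v u
        then Some (While i ((u ++ v) :: N'), 1 + lex_cost u v + size (u ++ v))
        else Some (For i.+1 N, 1 + lex_cost u v)
      else Some (For i.+1 N, 1)
  | Return N => None
  end.

Inductive nylF_run w : nylF_state -> seq (seq A) -> nat -> Prop :=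
| nylF_stop N : nylF_run w (Return N) N 0
| nylF_next c c' k N t :
    nylF_step w c = Some (c', k) -> nylF_run w c' N t ->
    nylF_run w c N (k + t).

(* On input w, the algorithm halts after t elementary operations and returns N *)
Definition nylF_halts w N (t : nat) : Prop := nylF_run w Init N t.

Lemma nylF_run_det w c N N' t t' :
  nylF_run w c N t -> nylF_run w c N' t' -> N = N' /\ t = t'.
Proof.
move=> run; elim: run N' t' => {c N t} [N|c c' k N t st _ IH] N' t' run'.
  by inversion run' => //; discriminate.
inversion run' as [|c1 c1' k1 N1 t1 st1 run1]; subst => //.
by move: st1; rewrite st => -[? ?]; subst; have [-> ->] := IH _ _ run1.
Qed.

End NyldonWords.

Arguments nylF_state {d} A.

Definition nylF_worst_case {d : Order.disp_t} (A : finOrderType d)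
    (n t : nat) : Prop :=
  (exists (w : seq A) N, size w = n /\ nylF_halts w N t) /\
  (forall (w : seq A) N t', size w = n -> nylF_halts w N t' -> t' <= t).

Definition bigO (f g : nat -> nat) : Prop :=
  exists C n0 : nat, forall n, n0 <= n -> f n <= C * g n.

(* Main.v *)
Require Import Defs.
From mathcomp Require Import all_boot all_order zify.
From Stdlib Require Import Classical.
Set Implicit Arguments.
Unset Strict Implicit.
Unset Printing Implicit Defensive.
Import Order.TTheory.

(** Three facts about Nyldon words carry the correctness of the algorithm.

    - In a Nyldon factorization the last factor is the longest Nyldon suffix
      of the word ([last_factor_longest]).
    - A Nyldon word is lexicographically at least each of its Nyldon suffixes
      ([nyldon_dominates_suffixes]).
    - If [u] is Nyldon, [u] minus its first letter is a product of Nyldon words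
      that [v] continues to a Nyldon factorization, and [u > v], then [u v] is
      Nyldon ([nyldon_merge]).

    The first two are proved together by induction on the length.  A Nyldon
    suffix longer than the last factor starts inside some earlier factor [n];
    factorizing the part of [n] that it covers gives, by domination inside [n],
    a last word that is at most [n], hence a nontrivial Nyldon factorization of
    the suffix, which is impossible.  Domination in turn compares the given
    suffix with a longer one, found by applying the first fact to a shorter
    word.  For the merge, the last factor of a putative nontrivial
    factorization of [u v] is a Nyldon suffix of [u v] without its first letter,
    so the first fact forces it to be [v]; what remains is a factorization of
    the Nyldon word [u], so [u <= v], a contradiction.

    The inner loop meets exactly the hypotheses of the merge: the head of the
    list is a letter followed by factors taken off the front of a
    nondecreasing list of Nyldon words.  So the list is, whenever the outer
    loop is tested, the Nyldon factorization of the suffix read so far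
    ([nylF_step_progress]).

    For the complexity, each iteration lengthens the list by one and each
    concatenation shortens it by one, so a linear potential drops at every
    step and there are at most [3 n] steps.  A step scans and copies at most
    [n] letters each, whence at most [3 n (2 n + 1)] operations, which is
    quadratic ([nylF_run_cost]). *)

Section Nyldon.
Context {d : Order.disp_t} {A : finOrderType d}.
Implicit Types (u v w p : seq A) (s t : seq (seq A)).

(** * The lexicographic order *)

Lemma lex_le_refl : reflexive (@lex_le d A).
Proof. by move=> u; apply: lexx. Qed.

Lemma lex_le_trans : transitive (@lex_le d A).
Proof. by move=> v u w; apply: le_trans. Qed.

Lemma lex_leNlt u v : lex_le u v = ~~ lex_lt v u.
Proof. exact: leNgt. Qed.

Lemma lex_ltW u v : lex_lt u v -> lex_le u v.
Proof. exact: ltW. Qed.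

Lemma lex_le_cat u v : lex_le u (u ++ v).
Proof.
case: v => [|b v]; first by rewrite cats0 lex_le_refl.
apply/lex_ltW/lex_ltP; left; split; first exact: prefix_prefix.
by move/(congr1 size); rewrite size_cat /= => /eqP; lia.
Qed.

(** * Nyldon words and factorizations *)

Lemma nyldon_size_gt0 u : nyldon u -> 0 < size u.
Proof. by case: u. Qed.

(** A nonempty word that is not Nyldon has, by the definition itself, a
    factorization into shorter Nyldon words; excluded middle is what extracts
    it. *)
Lemma nyldon_factorization_exists w :
  0 < size w -> exists s, nyldon_factorization w s.
Proof.
move=> w0; case: (classic (nyldon w)) => [nw|].
  by exists [:: w]; split; rewrite //= ?cats0 // => u; rewrite inE => /eqP->.
rewrite nyldonE => nnw; apply: NNPP => no; apply: nnw.
case: (ltngtP (size w) 1) => [|w2|]; [by lia | | by left].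
right; split=> // -[s [ns ew _ ss]].
by apply: no; exists s.
Qed.

Lemma nyldon_factorization_neq0 w s :
  nyldon_factorization w s -> 0 < size w -> s <> [::].
Proof. by move=> [_ -> _] + es; rewrite es. Qed.

Lemma size_flatten_nyldon_gt0 s :
  (forall u, u \in s -> nyldon u) -> s <> [::] -> 0 < size (flatten s).
Proof.
case: s => // u s ns _; rewrite /= size_cat ltn_addr //.
by apply/nyldon_size_gt0/ns/mem_head.
Qed.

Lemma size_mem_flatten u s : u \in s -> size u <= size (flatten s).
Proof.
elim: s => //= v s IH; rewrite inE size_cat => /orP[/eqP->|/IH]; lia.
Qed.

(** Factors being nonempty, each of two or more factors is strictly shorter
    than the product, as the definition of Nyldon words forbids. *)
Lemma nyldon_factorization_trivial w s :
  nyldon w -> nyldon_factorization w s -> s = [:: w].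
Proof.
move=> nw [ns ew ss].
case: s => [|u [|v s]] in ns ew ss *; first by rewrite ew in nw.
  by rewrite ew /= cats0.
have szs (x : seq A) : x \in [:: u, v & s] -> size x < size w.
  have := nyldon_size_gt0 (ns u (mem_head _ _)).
  have := nyldon_size_gt0 (ns v (mem_behead (s := [:: u, v & s]) (mem_head _ _))).
  rewrite ew /= !size_cat !inE => ? ? /or3P[/eqP->|/eqP->|/size_mem_flatten]; lia.
case/nyldonE: (nw) => [w1|[_ []]]; last by exists [:: u, v & s].
exfalso; have := szs u (mem_head _ _).
by have := nyldon_size_gt0 (ns u (mem_head _ _)); lia.
Qed.

(** * Suffixes of Nyldon words *)

(** The suffix [w] itself is allowed, so that the cases of a suffix starting at
    a factor boundary and strictly inside a factor need no distinction. *)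
Definition dominates_nyldon_suffixes w :=
  forall p v, w = p ++ v -> nyldon v -> lex_le v w.

(** Domination is assumed only for the factors, so that this can be used inside
    the induction that proves domination. Suppose that [v] starts inside the
    first factor [u], covering its suffix [q]. The last factor of [q] is a
    Nyldon suffix of [u], so it is at most [u], hence at most the factor that
    follows [u]; thus a factorization of [q] extends to one of [v] that has at
    least two factors. *)
Lemma last_factor_longest_cond s n p v :
  (forall u, u \in s -> dominates_nyldon_suffixes u) ->
  nyldon_factorization (p ++ v) (rcons s n) -> nyldon v -> size v <= size n.
Proof.
elim: s p => [|u s IH] p sufs [ns epv ss] nv.
  by move: epv; rewrite /= cats0 => <-; rewrite size_cat leq_addl.
have := epv; rewrite rcons_cons /=.
have [le_up epv'|lt_pu epv'] := leqP (size u) (size p).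
  have ep : p = u ++ drop (size u) p.
    have := congr1 (take (size u)) epv'.
    by rewrite takel_cat // take_size_cat // => e; rewrite -{1}e cat_take_drop.
  apply: (IH (drop (size u) p)) => //.
    by move=> x xs; apply: sufs; rewrite inE xs orbT.
  split; first by move=> x xs; apply: ns; rewrite inE xs orbT.
    by move/eqP: epv'; rewrite {1}ep -catA eqseq_cat // eqxx => /eqP.
  by move: ss; rewrite rcons_cons => /path_sorted.
have eu : u = p ++ drop (size p) u.
  have := congr1 (take (size p)) epv'.
  by rewrite take_size_cat // takel_cat 1?ltnW // => e; rewrite {1}e cat_take_drop.
(* q is the part of u that v covers. *)
set q := drop (size p) u in eu.
have ev : v = q ++ flatten (rcons s n).
  by move/eqP: epv'; rewrite {1}eu -catA eqseq_cat // eqxx => /eqP.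
have q0 : 0 < size q by rewrite size_drop subn_gt0.
have [t ft] := nyldon_factorization_exists q0.
have := nyldon_factorization_neq0 ft q0.
case: t ft => // x t [nt eq st] _.
have fv : nyldon_factorization v (x :: t ++ rcons s n).
  split.
  - move=> y; rewrite -cat_cons mem_cat => /orP[/nt//|ys].
    by apply: ns; rewrite inE ys orbT.
  - by rewrite -cat_cons flatten_cat -eq.
  move: ss; rewrite rcons_cons /= => ss; rewrite /= cat_path.
  apply/andP; split; first exact: st.
  apply: (path_le lex_le_trans _ ss).
  apply: (sufs u (mem_head _ _) (p ++ flatten (belast x t))); last first.
    by apply: nt; rewrite mem_last.
  by rewrite {1}eu eq lastI flatten_rcons catA.
have := nyldon_factorization_trivial nv fv.
by case=> _ /(congr1 size); rewrite size_cat size_rcons addnS.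
Qed.

Lemma sorted_rcons2 s (u v : seq A) :
  sorted lex_le (rcons (rcons s u) v) = sorted lex_le (rcons s u) && lex_le u v.
Proof. by case: s => [|x s] /=; rewrite ?andbT // !rcons_path last_rcons. Qed.

(** Let [w = p v], and let [n] be the last factor of [p]. If [n <= v], then [w]
    has a nontrivial factorization; so [v < n]. If [n = p], then
    [v < p <= p v]. Otherwise [n v] is shorter than [w], and its last factor [l]
    is no shorter than [v]. It cannot be [v], as that leaves a
    factorization of [n], so [n <= v]. Hence [l] is longer than [v], and
    [v <= l <= w] by the outer induction, on the length of [w], and the
    inner one, on the length of the prefix complementary to the suffix. *)
Lemma nyldon_dominates_suffixes w : nyldon w -> dominates_nyldon_suffixes w.
Proof.
have [m] := ubnP (size w); elim: m w => // m IHm w lt_wm nw p v.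
have [k] := ubnP (size p); elim: k p v => // k IHk p v lt_pk ew nv.
have [/size0nil p0|p0] := posnP (size p).
  by rewrite ew p0 lex_le_refl.
have [s0 fp] := nyldon_factorization_exists p0.
have := nyldon_factorization_neq0 fp p0.
case/lastP: s0 fp => // s n [ns ep ss] _.
have nn : nyldon n by apply: ns; rewrite mem_rcons mem_head.
have lt_vn : lex_lt v n.
  apply/negPn; rewrite -lex_leNlt; apply/negP => le_nv.
  suff /(nyldon_factorization_trivial nw)/(congr1 size) :
    nyldon_factorization w (rcons (rcons s n) v) by rewrite !size_rcons.
  split; last by rewrite sorted_rcons2 ss.
    by move=> x; rewrite mem_rcons inE => /orP[/eqP->|/ns].
  by rewrite flatten_rcons -ep.
have [s_0|/eqP s_n0] := eqVneq s [::].
  rewrite ew ep s_0 /= cats0.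
  exact: lex_le_trans (lex_ltW lt_vn) (lex_le_cat _ _).
have sgt0 : 0 < size (flatten s).
  by apply: size_flatten_nyldon_gt0 => // x xs; apply: ns; rewrite mem_rcons inE xs orbT.
have ew' : w = flatten s ++ n ++ v by rewrite ew ep flatten_rcons catA.
have nv0 : 0 < size (n ++ v).
  by rewrite size_cat ltn_addr // nyldon_size_gt0.
have [t0 fnv] := nyldon_factorization_exists nv0.
have := nyldon_factorization_neq0 fnv nv0.
case/lastP: t0 fnv => // t l fnv _; have [nt env st] := fnv.
have szw : size w = size (flatten s) + size (n ++ v) by rewrite ew' size_cat.
have nl : nyldon l by apply: nt; rewrite mem_rcons mem_head.
have env' := env; rewrite flatten_rcons in env'.
have sznv : size n + size v = size (flatten t) + size l by rewrite -!size_cat env'.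
have szw' : size w = size (flatten s) + (size n + size v) by rewrite szw size_cat.
have le_vl : size v <= size l.
  apply: last_factor_longest_cond fnv nv => x xt.
  apply: IHm; last by apply: nt; rewrite mem_rcons inE xt orbT.
  by have := size_mem_flatten xt; lia.
(* If l = v, then t factorizes n, so t = [n] and n <= v. *)
have [eq_vl|ne_vl] := eqVneq (size v) (size l).
  have e1 : size n = size (flatten t) by lia.
  move/eqP: env'; rewrite eqseq_cat //.
  case/andP=> /eqP en /eqP evl.
  have ft : nyldon_factorization n t.
    split=> //; first by move=> x xt; apply: nt; rewrite mem_rcons inE xt orbT.
    by move: st; rewrite -cats1 => /cat_sorted2[].
  move: st; rewrite (nyldon_factorization_trivial nn ft) -evl /= andbT.
  by rewrite lex_leNlt lt_vn.
have szp : size p = size (flatten s) + size n by rewrite ep flatten_rcons size_cat.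
(* Now v is a suffix of l, and l is a suffix of w longer than v. *)
apply: (@lex_le_trans l).
  apply: (IHm l _ nl (drop (size (flatten t)) n)) => //; first by lia.
  have := congr1 (drop (size (flatten t))) env'.
  by rewrite (drop_size_cat l) // drop_cat ifT => [->|]; last lia.
apply: (IHk (flatten s ++ flatten t)) => //; last by rewrite -catA -env'.
by rewrite size_cat; lia.
Qed.

Lemma last_factor_longest s n p v :
  nyldon_factorization (p ++ v) (rcons s n) -> nyldon v -> size v <= size n.
Proof.
move=> fpv; apply: last_factor_longest_cond (fpv) => u us.
apply: nyldon_dominates_suffixes; case: fpv => ns _ _.
by apply: ns; rewrite mem_rcons inE us orbT.
Qed.

(** The hypothesis on [s] cannot be replaced by the mere Nyldonness of [v]: it
    is what makes [v] the longest Nyldon suffix of [x v], which is where the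
    last factor of a nontrivial factorization of the product would lie. With
    letters 0 < 1, the words 101 and 0 are Nyldon and 101 > 0, but 1010 is the
    square of the Nyldon word 10. *)
Lemma nyldon_merge a x s v :
  nyldon (a :: x) -> nyldon_factorization (x ++ v) (rcons s v) ->
  lex_lt v (a :: x) -> nyldon ((a :: x) ++ v).
Proof.
move=> nu fxv lt_vu; have [nsv exv _] := fxv.
have nv : nyldon v by apply: nsv; rewrite mem_rcons mem_head.
have v0 := nyldon_size_gt0 nv.
apply/nyldonE; right; split; first by rewrite /= size_cat; lia.
move=> [t0 [nt euv szt st]].
have fuv : nyldon_factorization ((a :: x) ++ v) t0 by split.
have := nyldon_factorization_neq0 fuv isT.
case/lastP: t0 => // t l in nt euv szt st fuv * => _.
have nl : nyldon l by apply: nt; rewrite mem_rcons mem_head.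
have lt_l : size l < size ((a :: x) ++ v) by apply: szt; rewrite mem_rcons mem_head.
have euv' := euv; rewrite flatten_rcons in euv'.
have le_vl := last_factor_longest fuv nv.
have szE := congr1 size euv'; rewrite !size_cat in szE lt_l.
have le_lv : size l <= size v.
  apply: (@last_factor_longest s v (behead (flatten t)) l _ nl).
  suff <- : x ++ v = behead (flatten t) ++ l by exact: fxv.
  by case: (flatten t) euv' szE lt_l => [|b y] /=; [lia | case=> _ <-].
(* So l = v, and t factorizes the Nyldon word a :: x. *)
have e1 : size (a :: x) = size (flatten t) by lia.
move/eqP: euv'; rewrite eqseq_cat //.
case/andP=> /eqP en /eqP evl.
have ft : nyldon_factorization (a :: x) t.
  split=> //; first by move=> y yt; apply: nt; rewrite mem_rcons inE yt orbT.
  by move: st; rewrite -cats1 => /cat_sorted2[].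
move: st; rewrite (nyldon_factorization_trivial nu ft) -evl /= andbT.
by rewrite lex_leNlt lt_vu.
Qed.

(** * Running the algorithm *)

(** The cost of the first [m] steps. It makes the cost of a run a function of
    the input, so that its maximum over the words of a given length exists. *)
Fixpoint nylF_cost (m : nat) w (c : nylF_state A) : nat :=
  if m is m'.+1 then
    if nylF_step w c is Some (c', k) then k + nylF_cost m' w c' else 0
  else 0.

(** In the inner loop the first word of the list is the letter [a] read in this
    iteration, followed by the factors [s] already absorbed; those and the rest
    of the list form the factorization that was known before [a] was read. *)
Definition nylF_inv w (c : nylF_state A) : Prop :=
  match c with
  | Init => 0 < size w
  | For i N =>
      0 < i <= size w /\ nyldon_factorization (drop (size w - i) w) N
  | While i N =>
      0 < i < size w /\
      exists a x s N',
        [/\ N = (a :: x) :: N', nyldon (a :: x), x = flatten s,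
            drop (size w - i.+1) w = a :: drop (size w - i) w
          & nyldon_factorization (drop (size w - i) w) (s ++ N')]
  | Return N => nyldon_factorization w N
  end.

(** Each unread letter accounts for one test of the outer loop, one test that
    ends the inner loop and one concatenation. *)
Definition nylF_potential w (c : nylF_state A) : nat :=
  match c with
  | Init => 3 * size w
  | For i N => 3 * (size w - i) + size N + 1
  | While i N => 3 * (size w - i.+1) + size N + 2
  | Return _ => 0
  end.

Lemma lex_cost_le u v : lex_cost u v <= size u.
Proof. by elim: u v => [|a u IH] [|b v] //=; case: ifP => _ //; apply: IH. Qed.

Lemma nyldon1 (a : A) : nyldon [:: a].
Proof. by left. Qed.

Lemma nyldon_factorization1 u : nyldon u -> nyldon_factorization u [:: u].
Proof. by move=> nu; split; rewrite //= ?cats0 // => v; rewrite inE => /eqP->. Qed.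

Lemma letter_drop w i : 0 < i <= size w ->
  exists2 a, letter w i = Some a & drop i.-1 w = a :: drop i w.
Proof.
case: i => // i /= lt_iw; case: w lt_iw => // a0 w lt_iw.
exists (nth a0 (a0 :: w) i); last exact: drop_nth.
by rewrite onthE (nth_map a0).
Qed.

(** If the guard of the inner loop fails, the head of the list is at most the
    next word, so the list has become a factorization; if it holds,
    [nyldon_merge] keeps the head Nyldon. The bound on the cost of a step
    holds because the words compared and concatenated are consecutive factors
    of the input. *)
Lemma nylF_step_progress w c : nylF_inv w c ->
  (exists N, c = Return N) \/
  exists c' k, [/\ nylF_step w c = Some (c', k), nylF_inv w c',
                   nylF_potential w c' < nylF_potential w c
                 & k <= 2 * size w + 1].
Proof.
case: c => [|i N|i N|N] /=; last by left; exists N.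
- move=> w0; right.
  have [a -> ea] := @letter_drop w (size w) ltac:(by rewrite w0 leqnn).
  exists (For 1 [:: [:: a]]), 1; split=> //=; try lia.
  split; first by rewrite w0.
  by rewrite subn1 ea drop_size; apply/nyldon_factorization1/nyldon1.
- move=> [/andP[i0 le_in] fN]; right; case: leqP => [lt_in|ge_in].
    have [|a -> ea] := @letter_drop w (size w - i); first by lia.
    exists (While i ([:: a] :: N)), 1; split=> //=; try lia.
    split; first by lia.
    by exists a, [::], [::], N; split; rewrite ?subnS ?ea //; exact: nyldon1.
  exists (Return N), 1; split=> //=; try lia.
  have eqi : size w - i = 0 by lia.
  by rewrite eqi drop0 in fN.
move=> [/andP[i0 lt_in] [a [x [s [N' [-> nu ex ew [ns eN ss]]]]]]]; right.
have ew' : drop (size w - i.+1) w = (a :: x) ++ flatten N'.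
  by rewrite ew eN flatten_cat ex.
have szw : size (a :: x) + size (flatten N') <= size w.
  by rewrite -size_cat -ew' size_drop leq_subr.
have nN' y : y \in N' -> nyldon y by move=> yN; apply: ns; rewrite mem_cat yN orbT.
case: N' => [|v N'] in ns eN ss ew' szw nN' *.
  exists (For i.+1 [:: a :: x]), 1; split=> //=; try lia.
  by split=> //; rewrite ew' cats0; apply: nyldon_factorization1.
have le_cost := lex_cost_le (a :: x) v.
case: ifP => [lt_vu|nlt_vu]; last first.
  exists (For i.+1 [:: a :: x, v & N']), (1 + lex_cost (a :: x) v).
  split=> //; [| by rewrite /=; lia | by lia].
  split; first by rewrite lt_in.
  split=> //.
    by move=> y; rewrite inE => /orP[/eqP-> //|/nN'].
  by rewrite /= lex_leNlt nlt_vu; case/cat_sorted2: ss.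
exists (While i (((a :: x) ++ v) :: N')),
  (1 + lex_cost (a :: x) v + size ((a :: x) ++ v)).
rewrite /nylF_potential; split=> //; last 1 first.
- have sz_uv : size ((a :: x) ++ v) <= size w.
    by move: szw; rewrite /= !size_cat; lia.
  have sz_u : size (a :: x) <= size ((a :: x) ++ v) by rewrite size_cat leq_addr.
  by lia.
- split; first by rewrite i0.
  exists a, (x ++ v), (rcons s v), N'; split=> //; last first.
  - by rewrite -cats1 -catA.
  - by rewrite flatten_rcons ex.
  apply: (nyldon_merge (s := s)) nu _ lt_vu; split.
  - by move=> y yv; apply: ns; rewrite -cat_rcons mem_cat yv.
  - by rewrite flatten_rcons ex.
  by move: ss; rewrite -cat_rcons => /cat_sorted2[].
by rewrite /=; lia.
Qed.

Lemma nylF_run_cost m w c :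
  nylF_inv w c -> nylF_potential w c <= m ->
  exists N, [/\ nylF_run w c N (nylF_cost m w c), nyldon_factorization w N
              & nylF_cost m w c <= m * (2 * size w + 1)].
Proof.
elim: m c => [|m IH] c inv_c le_cm;
  have [[N ec]|[c' [k [st inv_c' lt_c le_k]]]] := nylF_step_progress inv_c.
- by rewrite ec in inv_c *; exists N; split=> //; apply: nylF_stop.
- by lia.
- by rewrite ec in inv_c *; exists N; split=> //; apply: nylF_stop.
have [|N [rN fN leN]] := IH c' inv_c'; first by lia.
exists N; rewrite /= st; split=> //; last by rewrite mulSn leq_add.
exact: nylF_next st rN.
Qed.

End Nyldon.

Theorem proposition18 (d : Order.disp_t) (A : finOrderType d)
    (hA : 2 <= #|A|) :
  (forall w : seq A, w <> [::] ->
     exists N t, nylF_halts w N t /\ nyldon_factorization w N) /\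
  (exists T : nat -> nat,
     (forall n, 1 <= n -> nylF_worst_case A n (T n)) /\
     bigO T (fun n => (n * (n - 1)) %/ 2)).
Proof.
pose cost (w : seq A) := nylF_cost (3 * size w) w Init.
have halts w : 0 < size w -> exists N, [/\ nylF_halts w N (cost w),
    nyldon_factorization w N & cost w <= 3 * size w * (2 * size w + 1)].
  by move=> w0; apply: nylF_run_cost.
split=> [[//|a w] _|].
  by have [N [hN fN _]] := halts (a :: w) isT; exists N, (cost (a :: w)).
exists (fun n => \max_(w : n.-tuple A) cost w); split=> [n n0|].
  have tuples0 : 0 < #|{: n.-tuple A}| by rewrite card_tuple expn_gt0 (ltnW hA).
  split.
    have [w ->] := bigop.eq_bigmax (fun w : n.-tuple A => cost w) tuples0.
    have [|N [hN _ _]] := halts w; first by rewrite size_tuple.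
    by exists w, N; rewrite size_tuple.
  move=> w N t szw hw; have [|N' [hN' _ _]] := halts w; first by rewrite szw.
  have [_ ->] := nylF_run_det hw hN'.
  have /eqP szw' := szw.
  exact: (bigop.leq_bigmax (F := fun w : n.-tuple A => cost w) (Tuple szw')).
(* 3n(2n+1) <= 30 n(n-1)/2 for n >= 2, while the right-hand side is 0 at n = 1. *)
exists 30, 2 => n n2; apply/bigop.bigmax_leqP => w _.
have [|N [_ _]] := halts w; first by rewrite size_tuple; lia.
rewrite size_tuple => /leq_trans; apply.
have -> : n * (n - 1) %/ 2 = 'C(n, 2) by rewrite bin2 subn1 divn2.
have := mul_bin_diag n 1; rewrite bin1; nia.
Qed.
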